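(* Let $r\ge 1$, $\mathfrak{g}=\mathfrak{sl}_{r+1}(\mathbb{C})$, let $\lambda$ be a dominant integral weight of $\mathfrak{g}$, represented by a tuple $\underline{\lambda}=(\lambda_1\geq\cdots\geq\lambda_{r+1})$, let $V(\lambda)$ be the irreducible representation with highest weight $\lambda$, and let $v_\lambda$ be a fixed non-zero highest weight vector. Let $\mathcal{P}(\underline{\lambda})$ be the set of integral patterns with bounding sequence $\underline{\lambda}$, let $\{\xi_{\mathcal{P}}\}_{\mathcal{P}\in\mathcal{P}(\underline{\lambda})}$ be the Gelfand-Tsetlin basis of $V(\lambda)$ and $\{v_{\mathcal{P}}\}_{\mathcal{P}\in\mathcal{P}(\underline{\lambda})}$ the Chari-Loktev basis of $V(\lambda)$, and let $\geq$ be the row-wise dominance order on $\mathcal{P}(\underline{\lambda})$ (all as defined in the context). Then for every pattern $\mathcal{P}\in\mathcal{P}(\underline{\lambda})$ with rows $\underline{\lambda}^1,\ldots,\underline{\lambda}^r,\underline{\lambda}^{r+1}=\underline{\lambda}$, in the expression of $v_{\mathcal{P}}$ as a linear combination of the Gelfand-Tsetlin basis only those $\xi_{\mathcal{P}'}$ with $\mathcal{P}'\geq\mathcal{P}$ appear; that is, there are scalars $c^{\mathcal{P}'}_{\mathcal{P}}$ with $$v_{\mathcal{P}}=\sum_{\mathcal{P}'\in\mathcal{P}(\underline{\lambda}),\ \mathcal{P}'\geq\mathcal{P}} c^{\mathcal{P}'}_{\mathcal{P}}\,\xi_{\mathcal{P}'}.$$ Moreover, the diagonal coefficient is $$c^{\mathcal{P}}_{\mathcal{P}}=\prod_{1\leq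 i<j\leq r+1}\ \prod_{p=i}^{j-1}\frac{(\ell^{j-1}_i-\ell^{j-1}_p)!}{(\ell^j_i-\ell^{j-1}_p)!},\qquad\text{where } \ell^j_i:=\lambda^j_i-i+1.$$
   Context: **Weights.** $\mathfrak{g}=\mathfrak{sl}_{r+1}(\mathbb{C})$, with Cartan subalgebra the diagonal trace-zero matrices and Borel subalgebra the upper triangular ones. $\epsilon_i$ is the linear functional sending a diagonal matrix to its $(i,i)$ entry. A tuple $(a_1,\ldots,a_{r+1})$ represents the weight $\sum a_i\epsilon_i$; two tuples represent the same weight iff they differ by a multiple of $(1,\ldots,1)$. The weight is dominant integral if all $a_i-a_{i+1}$ are non-negative integers. $\underline{\lambda}=(\lambda_1,\ldots,\lambda_{r+1})$ is an arbitrarily fixed tuple of real numbers representing the dominant integral weight $\lambda$. **Patterns.** A pattern is a sequence $\underline{\pi}^1,\ldots,\underline{\pi}^{r+1}$ (its rows) of non-increasing sequences of real numbers, $\underline{\pi}^j$: $\pi^j_1\geq\cdots\geq\pi^j_j$ of length $j$, with $\pi^j_i\geq\pi^{j-1}_i\geq\pi^j_{i+1}$ for all $1\leq i<j\leq r+1$. Its bounding sequence is $\underline{\pi}^{r+1}$. It is integral if all differences $\pi^j_i-\pi^{j-1}_i$ and $\pi^{j-1}_i-\pi^j_{i+1}$ ($1\leq i<j\leq r+1$) are integers. $\mathcal{P}(\underline{\lambda})$ is the set of integral patterns with bounding sequence $\underline{\lambda}$. The weight of a pattern with rows $\underline{\lambda}^1,\ldots,\underline{\lambda}^{r+1}$ is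 $\sum_k\mu_k\epsilon_k$, $\mu_k=\sum_{i=1}^k\lambda^k_i-\sum_{i=1}^{k-1}\lambda^{k-1}_i$. There is a unique pattern in $\mathcal{P}(\underline{\lambda})$ of weight $\lambda$ (it has $\lambda^k_i=\lambda_i$ for all $i\le k$). **Row-wise dominance order.** For $\mathcal{P}$ with rows $\underline{\lambda}^j$ and $\mathcal{P}'$ with rows $\underline{\lambda}'^j$ in $\mathcal{P}(\underline{\lambda})$, $\mathcal{P}'\geq\mathcal{P}$ means $\lambda'^j_1+\cdots+\lambda'^j_i\geq\lambda^j_1+\cdots+\lambda^j_i$ for all $1\leq i\leq j\leq r+1$. **Gelfand-Tsetlin basis** (known theorem of Gelfand-Tsetlin, in Molev's form). $E_{i,j}$ is the $(r+1)\times(r+1)$ matrix unit. $\{\xi_{\mathcal{P}}\}_{\mathcal{P}\in\mathcal{P}(\underline{\lambda})}$ is the basis of $V(\lambda)$ such that $\xi_{\mathcal{P}}=v_\lambda$ for the unique pattern $\mathcal{P}$ of weight $\lambda$ and, for every $1\leq k<r+1$ and every $\mathcal{P}$ with rows $\underline{\lambda}^j$, with $\ell^j_i:=\lambda^j_i-i+1$: $$(E_{k,k}-E_{k+1,k+1})\xi_{\mathcal{P}}=\Big(\big(\textstyle\sum_{i=1}^k\lambda^k_i-\sum_{i=1}^{k-1}\lambda^{k-1}_i\big)-\big(\sum_{i=1}^{k+1}\lambda^{k+1}_i-\sum_{i=1}^k\lambda^k_i\big)\Big)\xi_{\mathcal{P}},$$ $$E_{k,k+1}\xi_{\mathcal{P}}=-\sum_{i=1}^k\frac{\prod_{q=1}^{k+1}(\ell^k_i-\ell^{k+1}_q)}{\prod_{1\le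 q\le k,\,q\neq i}(\ell^k_i-\ell^k_q)}\,\xi_{\mathcal{P}+\delta^k_i},\qquad E_{k+1,k}\xi_{\mathcal{P}}=\sum_{i=1}^k\frac{\prod_{q=1}^{k-1}(\ell^k_i-\ell^{k-1}_q)}{\prod_{1\le q\le k,\,q\neq i}(\ell^k_i-\ell^k_q)}\,\xi_{\mathcal{P}-\delta^k_i},$$ where $\mathcal{P}\pm\delta^k_i$ is obtained from $\mathcal{P}$ by replacing $\lambda^k_i$ by $\lambda^k_i\pm1$, and $\xi_{\mathcal{P}\pm\delta^k_i}:=0$ if $\mathcal{P}\pm\delta^k_i$ is not a pattern. **Chari-Loktev basis** (known to be a basis). For $1\leq i\leq j\leq r$ let $x^-_{ij}:=E_{j+1,i}$. For $\mathcal{P}\in\mathcal{P}(\underline{\lambda})$ with rows $\underline{\lambda}^j$ and $\ell^j_i=\lambda^j_i-i+1$, put $\Theta^j_{\mathcal{P}}:=\prod_{i=1}^j(x^-_{ij})^{(\ell^{j+1}_i-\ell^j_i)}$ for $1\leq j\leq r$, where $T^{(n)}:=T^n/n!$ (the factors commute for fixed $j$), $\Theta_{\mathcal{P}}:=\Theta^1_{\mathcal{P}}\Theta^2_{\mathcal{P}}\cdots\Theta^r_{\mathcal{P}}$ (in this order), and $v_{\mathcal{P}}:=\Theta_{\mathcal{P}}v_\lambda$. *)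

(* Defs.v *)
From mathcomp Require Import all_boot all_order all_algebra.
From mathcomp Require Import finmap.
From mathcomp Require Import all_classical reals.
From mathcomp Require Import complex.
From mathcomp Require Import zify lra.

Set Implicit Arguments.
Unset Strict Implicit.
Unset Printing Implicit Defensive.

Import Order.TTheory GRing.Theory Num.Theory.

Local Open Scope classical_set_scope.
Local Open Scope ring_scope.

Section Patterns.
Variables (R : realType) (r : nat).

(* Indices are 1-based: P j i is the i-th entry of the j-th row.  The tuple
   [lam], as any sequence in the library, is 0-based. *)
Definition pattern : Type := nat -> nat -> R.

Definition dominant_integral (lam : r.+1.-tuple R) : Prop :=
  forall i, (i < r)%N -> lam`_i - lam`_i.+1 \is a Num.nat.

(* The first clause gives every pattern a single representative among
   the functions nat -> nat -> R, so that equality of patterns is Leibniz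
   equality. *)
Definition is_pattern (P : pattern) : Prop :=
  [/\ forall j i, ~~ ((1 <= i <= j) && (j <= r.+1))%N -> P j i = 0,
      forall j i, (1 <= i < j)%N -> (j <= r.+1)%N -> P j i >= P j i.+1
    & forall j i, (1 <= i < j)%N -> (j <= r.+1)%N ->
        P j i >= P j.-1 i /\ P j.-1 i >= P j i.+1].

Definition is_integral (P : pattern) : Prop :=
  forall j i, (1 <= i < j)%N -> (j <= r.+1)%N ->
    P j i - P j.-1 i \is a Num.int /\ P j.-1 i - P j i.+1 \is a Num.int.

Definition has_bounding (lam : r.+1.-tuple R) (P : pattern) : Prop :=
  forall i, (1 <= i <= r.+1)%N -> P r.+1 i = lam`_i.-1.

Definition patterns (lam : r.+1.-tuple R) : set pattern :=
  [set P | [/\ is_pattern P, is_integral P & has_bounding lam P]].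

Definition pattern_weight (P : pattern) (k : nat) : R :=
  \sum_(1 <= i < k.+1) P k i - \sum_(1 <= i < k) P k.-1 i.

(* Equality of weights of sl: equality of tuples up to multiples of
   (1, ..., 1). *)
Definition has_weight (lam : r.+1.-tuple R) (P : pattern) : Prop :=
  exists a : R, forall k, (1 <= k <= r.+1)%N ->
    pattern_weight P k = lam`_k.-1 + a.

(* rowwise_ge P' P is P' >= P. *)
Definition rowwise_ge (P' P : pattern) : Prop :=
  forall i j, (1 <= i <= j)%N -> (j <= r.+1)%N ->
    \sum_(1 <= q < i.+1) P' j q >= \sum_(1 <= q < i.+1) P j q.

Definition ell (P : pattern) (j i : nat) : R := P j i - i%:R + 1.

(* P + a delta^k_i *)
Definition shift (a : R) (k i : nat) (P : pattern) : pattern :=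
  fun j q => if (j == k) && (q == i) then P j q + a else P j q.

Lemma patterns_bounds (lam : r.+1.-tuple R) (P : pattern) :
    dominant_integral lam -> patterns lam P ->
  forall d j i, (j + d = r.+1)%N -> (1 <= i <= j)%N ->
    [/\ lam`_r <= P j i, P j i <= lam`_0 & lam`_0 - P j i \is a Num.int].
Proof.
move=> dom [[_ _ il] int bd]; elim=> [|d IHd] j i jd ij.
  have -> : j = r.+1 by lia.
  rewrite bd; last by lia.
  have {ij jd}: (i.-1 <= r)%N by lia.
  move: i.-1 => {}i ir.
  have nn m n : (m + n <= r)%N -> lam`_m - lam`_(m + n) \is a Num.nat.
    elim: n => [|n IHn] mn; first by rewrite addn0 subrr rpred0.
    rewrite addnS (_ : _ - _ =
      (lam`_m - lam`_(m + n)) + (lam`_(m + n) - lam`_(m + n).+1)); last lra.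
    by rewrite rpredD ?IHn ?dom//; lia.
  have h0 := nn 0%N i ir.
  have := nn i (r - i)%N; rewrite subnKC// => /(_ (leqnn _)) h1.
  split; last exact: intr_nat.
  - by rewrite -subr_ge0 natr_ge0.
  - by rewrite -subr_ge0 natr_ge0.
have [||/= h2 h1] := il j.+1 i; do ?lia.
have [||/= i1 _] := int j.+1 i; do ?lia.
have [||a1 a2 a3] := IHd j.+1 i; do ?lia.
have [||b1 b2 b3] := IHd j.+1 i.+1; do ?lia.
split; [exact: le_trans b1 h1|exact: le_trans h2 a2|].
rewrite (_ : _ - _ = (lam`_0 - P j.+1 i) + (P j.+1 i - P j i)); last lra.
exact: rpredD.
Qed.

Lemma finite_patterns (lam : r.+1.-tuple R) :
  dominant_integral lam -> finite_set (patterns lam).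
Proof.
move=> dom; pose N := Num.truncn (lam`_0 - lam`_r).
pose F (f : {ffun 'I_r.+2 * 'I_r.+2 -> 'I_N.+1}) : pattern := fun j i =>
  if ((1 <= i <= j) && (j <= r.+1))%N then lam`_0 - (f (inord j, inord i))%:R else 0.
apply: (@sub_finite_set _ _ (F @` setT)); last exact/finite_image/finite_finset.
move=> P PL; exists [ffun x : 'I_r.+2 * 'I_r.+2 => inord (Num.truncn (lam`_0 - P x.1 x.2))] => //.
apply/funext => j; apply/funext => i; rewrite /F.
case: ifPn => [ij|nij]; last by case: PL => -[-> ].
have [||h1 h2 h3] := patterns_bounds dom PL (d := r.+1 - j) (j := j) (i := i);
  do ?lia.
rewrite ffunE /= !inordK; do ?lia.
  have: lam`_0 - P j i \is a Num.nat by rewrite natrEint h3 subr_ge0.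
  by move=> /truncnK ->; rewrite opprB addrC subrK.
by rewrite ltnS /N le_truncn// lerD2l lerN2.
Qed.

End Patterns.

Section Representation.
Variables (R : realType) (r : nat) (V : vectType R[i]).

(* A representation of sl_{r+1} is given by a function on all matrices of
   which only the values at trace-zero matrices are relevant. *)
Variable rho : 'M[R[i]]_r.+1 -> 'End(V).

Definition sl_representation : Prop :=
  forall A B : 'M[R[i]]_r.+1, \tr A = 0 -> \tr B = 0 ->
    (forall a : R[i], rho (a *: A + B) = a *: rho A + rho B) /\
    rho (A *m B - B *m A) = ((rho A \o rho B) - (rho B \o rho A))%VF.

Definition irreducible_rep : Prop :=
  {:V}%VS != 0%VS /\
  forall U : {vspace V},
    (forall A : 'M[R[i]]_r.+1, \tr A = 0 -> (rho A @: U <= U)%VS) ->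
    U = 0%VS \/ U = {:V}%VS.

Definition weight_fun (lam : r.+1.-tuple R) (A : 'M[R[i]]_r.+1) : R[i] :=
  \sum_(i < r.+1) (lam`_i)%:C%C * A i i.

Definition highest_weight_vector (lam : r.+1.-tuple R) (v : V) : Prop :=
  [/\ v != 0,
      forall A : 'M[R[i]]_r.+1, is_diag_mx A -> \tr A = 0 ->
        rho A v = weight_fun lam A *: v
    & forall i j : 'I_r.+1, (i < j)%N -> rho (delta_mx i j) v = 0].

(* The matrix unit E_{i,j}, with 1-based indices 1 <= i, j <= r+1. *)
Definition E (i j : nat) : 'M[R[i]]_r.+1 := delta_mx (inord i.-1) (inord j.-1).

(* xi is only relevant on patterns lam; elsewhere it is replaced by 0. *)
Definition xi0 (lam : r.+1.-tuple R) (xi : pattern R -> V) (P : pattern R) : V :=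
  if P \in patterns lam then xi P else 0.

(* patterns lam is finite by finite_patterns, so that fset_set enumerates it. *)
Definition gelfand_tsetlin_basis (lam : r.+1.-tuple R) (v : V)
    (xi : pattern R -> V) : Prop :=
  [/\ basis_of {:V}%VS [seq xi P | P <- fset_set (patterns lam)],
      forall P, patterns lam P -> has_weight lam P -> xi P = v
    & forall P k, patterns lam P -> (1 <= k < r.+1)%N ->
      [/\ rho (E k k - E k.+1 k.+1) (xi P) =
            (pattern_weight P k - pattern_weight P k.+1)%:C%C *: xi P,
          rho (E k k.+1) (xi P) =
            - \sum_(1 <= i < k.+1)
                ((\prod_(1 <= q < k.+2) (ell P k i - ell P k.+1 q)) /
                 (\prod_(1 <= q < k.+1 | q != i) (ell P k i - ell P k q)))%:C%C
                *: xi0 lam xi (shift 1 k i P)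
        & rho (E k.+1 k) (xi P) =
            \sum_(1 <= i < k.+1)
                ((\prod_(1 <= q < k) (ell P k i - ell P k.-1 q)) /
                 (\prod_(1 <= q < k.+1 | q != i) (ell P k i - ell P k q)))%:C%C
                *: xi0 lam xi (shift (-1) k i P)]].

Definition divided_power (T : 'End(V)) (n : nat) : 'End(V) :=
  (n`!%:R : R[i])^-1 *: iter n (comp_lfun T) \1%VF.

(* The differences of ell's below are non-negative integers when P belongs to
   patterns lam, so Num.truncn only changes their type. *)
Definition Theta_row (P : pattern R) (j : nat) : 'End(V) :=
  \big[@comp_lfun _ V V V / \1%VF]_(1 <= i < j.+1)
    divided_power (rho (E j.+1 i)) (Num.truncn (ell P j.+1 i - ell P j i)).

Definition Theta (P : pattern R) : 'End(V) :=
  \big[@comp_lfun _ V V V / \1%VF]_(1 <= j < r.+1) Theta_row P j.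

Definition chari_loktev (v : V) (P : pattern R) : V := Theta P v.

End Representation.

Definition diagonal_coef (R : realType) (r : nat) (P : pattern R) : R[i] :=
  \prod_(1 <= j < r.+2) \prod_(1 <= i < j) \prod_(i <= p < j)
    ((Num.truncn (ell P j.-1 i - ell P j.-1 p))`!%:R /
     (Num.truncn (ell P j i - ell P j.-1 p))`!%:R).

(* Main.v *)
(* The matrix unit E_{n,i}, i < n, fixes the rows n, ..., r+1 of a pattern and
   lowers the sums of the rows i, ..., n-1 by 1.  So in every pattern occurring in
   Theta^j ... Theta^r v the row k has sum lambda^j_1 + ... + lambda^j_k, for
   k <= j.  By interlacing the sum of row i is at most the sum of the first i
   entries of row j, and row j is not changed by Theta^1, ..., Theta^(j-1).

   For the diagonal coefficient, apply the factors E_{n,i} of Theta^(n-1) one at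
   a time, from i = n-1 down to i = 1.  While E_{n,i} acts, the entries q < i of
   row n-1 are still equal to those of row n, the largest possible values, so
   that among the patterns present only the one with row n-1 equal to the current
   gl_(n-1)-weight mu and with rows k < n-1 the truncations of mu contributes to
   the next pattern of this kind.  By induction on n, with
   E_{n+1,i} = [E_{n+1,n}, E_{n,i}], its contribution is the product over
   i < p < n of 1 / ((mu_i - i) - (mu_p - p)), and these telescope to quotients
   of factorials. *)
Require Import Defs.
From mathcomp Require Import all_boot all_order all_algebra.
From mathcomp Require Import finmap.
From mathcomp Require Import all_classical reals.
From mathcomp Require Import complex.
From mathcomp Require Import zify ring lra.

Set Implicit Arguments.
Unset Strict Implicit.
Unset Printing Implicit Defensive.

Import Order.TTheory GRing.Theory Num.Theory.

Local Open Scope classical_set_scope.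
Local Open Scope ring_scope.

(** * Coordinate functionals of a basis indexed by a sequence *)

Lemma basis_coef (K : fieldType) (V : vectType K) (T : choiceType) (s : seq T)
    (f : T -> V) : uniq s -> basis_of {:V}%VS [seq f x | x <- s] ->
  exists coef : T -> {scalar V},
    (forall u, u = \sum_(x <- s) coef x u *: f x) /\
    (forall x y, x \in s -> y \in s -> coef x (f y) = (x == y)%:R).
Proof.
move=> us bs.
pose X : (size s).-tuple V := map_tuple f (in_tuple s).
(* The functionals are indexed by elements of [s] instead of positions, by way of [index]; outside
   [s] they are 0. *)
pose coef x : {scalar V} :=
  if insub (index x s) is Some i then coord X i : {scalar V} else \0.
have coefE (i : 'I_(size s)) x0 u : coef (nth x0 s i) u = coord X i u.
  by rewrite /coef index_uniq// valK.
have XE (i : 'I_(size s)) x0 : X`_i = f (nth x0 s i).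
  by rewrite /X /= (nth_map x0).
exists coef; split=> [u|x y xs ys].
  rewrite [LHS](coord_basis (X := X) bs (memvf u)).
  case: s us bs @X @coef coefE XE => [|x0 s'] us bs X coef coefE XE.
    by rewrite big_ord0 big_nil.
  rewrite (big_nth x0) big_mkord; apply: eq_bigr => i _.
  by rewrite (XE _ x0) coefE.
have ix : (index x s < size s)%N by rewrite index_mem.
have iy : (index y s < size s)%N by rewrite index_mem.
have := @coord_free _ _ _ X (Ordinal iy) (Ordinal ix) (basis_free bs).
rewrite -(coefE _ x _) (XE _ x) /= !nth_index// => ->; rewrite -val_eqE /=; congr (_ %:R).
by congr nat_of_bool; apply/eqP/eqP => [e|-> //]; rewrite -(nth_index x xs) -e nth_index.
Qed.

(** * Entries of patterns, flat patterns, and moves between patterns *)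

Section PatternLemmas.
Variables (R : realType) (r : nat) (lam : r.+1.-tuple R).
Hypothesis lam_dom : dominant_integral lam.
Local Notation pat := (patterns lam).
Implicit Types (P Q : pattern R) (mu : nat -> R).

Lemma eq_sum_le (f g : nat -> R) k :
    (forall q, (1 <= q <= k)%N -> f q <= g q) ->
    \sum_(1 <= q < k.+1) f q = \sum_(1 <= q < k.+1) g q ->
  forall q, (1 <= q <= k)%N -> f q = g q.
Proof.
move=> fg /eqP; rewrite eq_sym -subr_eq0 -sumrB big_nat_cond psumr_eq0; last first.
  by move=> q; rewrite andbT subr_ge0 => qk; apply: fg; lia.
move=> /allP h q qk; have := h q; rewrite mem_index_iota andbT.
by rewrite ltnS qk => /(_ isT) /= /eqP; lra.
Qed.

Lemma pattern_col_mono P : pat P -> forall k n i, (1 <= i <= k)%N ->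
  (k <= n <= r.+1)%N -> P k i <= P n i.
Proof.
move=> [[_ _ il] _ _] k n i ik kn.
have -> : n = (k + (n - k))%N by lia.
have : (k + (n - k) <= r.+1)%N by lia.
elim: (n - k)%N => [|d IHd] kd; first by rewrite addn0.
have [||h _] := il (k + d.+1)%N i; do ?lia.
by apply: le_trans h; rewrite addnS; apply: IHd; lia.
Qed.

Lemma pattern_row_mono P : pat P -> forall k i j, (1 <= i <= j)%N ->
  (j <= k <= r.+1)%N -> P k j <= P k i.
Proof.
move=> [[_ dec _] _ _] k i j ij jk.
have -> : j = (i + (j - i))%N by lia.
have : (i + (j - i) <= k)%N by lia.
elim: (j - i)%N => [|d IHd] kd; first by rewrite addn0.
apply: (le_trans _ (IHd _)); last lia.
by rewrite addnS; apply: dec; lia.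
Qed.

Lemma pattern_int P : pat P -> forall j i j' i', (1 <= i <= j)%N ->
  (j <= r.+1)%N -> (1 <= i' <= j')%N -> (j' <= r.+1)%N ->
  P j i - P j' i' \is a Num.int.
Proof.
move=> PP j i j' i' ij jr ij' jr'.
have [|//|_ _ h] := patterns_bounds lam_dom PP (d := r.+1 - j) (j := j) (i := i).
  lia.
have [|//|_ _ h'] := patterns_bounds lam_dom PP (d := r.+1 - j') (j := j') (i := i').
  lia.
rewrite (_ : _ - _ = (lam`_0 - P j' i') - (lam`_0 - P j i)); last by lra.
exact: rpredB.
Qed.

(* For n = r+1 and mu = lambda this is the pattern of weight lambda; in general
   xi at this pattern is a highest weight vector for gl_(n-1) of weight mu. *)
Definition flat n mu P : pattern R := fun j q =>
  if (j < n)%N then (if (1 <= q <= j)%N then mu q else 0) else P j q.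

Lemma eq_flat n mu mu' P : (forall q, (1 <= q < n)%N -> mu q = mu' q) ->
  flat n mu P = flat n mu' P.
Proof.
move=> h; apply/funext => j; apply/funext => q; rewrite /flat.
by case: ltnP => // jn; case: ifP => // qj; apply: h; lia.
Qed.

Lemma flat_pred n P : pat P -> (n <= r.+1)%N ->
  flat n.+1 (P n) P = flat n (P n) P.
Proof.
move=> [[P0 _ _] _ _] nr; apply/funext => j; apply/funext => q; rewrite /flat ltnS.
case: (ltngtP j n) => // [->]; case: (ifPn (1 <= q <= n)%N) => // qn; rewrite P0//.
by apply: contra qn => /andP[].
Qed.

Lemma flat1 mu P : pat P -> flat 1 mu P = P.
Proof.
move=> [[P0 _ _] _ _]; apply/funext => -[|j]; apply/funext => q; rewrite /flat//=.
by rewrite P0; [case: ifP => //; lia|lia].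
Qed.

(** Below row [n] the columns are constant and from row [n] on nothing changes, so the new
    interlacing condition is the one between rows n-1 and n. It also makes [mu] non-increasing, by
    comparison with [P n q.+1]. *)
Lemma flat_pattern n mu P : pat P -> (n <= r.+1)%N ->
    (forall q, (1 <= q < n)%N -> [/\ P n q.+1 <= mu q, mu q <= P n q
       & P n q - mu q \is a Num.int]) ->
  pat (flat n mu P).
Proof.
move=> PP; have [[P0 dec il] int bd] := PP => nr H.
have key j i : (1 <= i < j)%N -> (j <= r.+1)%N ->
    [/\ flat n mu P j i - flat n mu P j.-1 i \is a Num.int,
        flat n mu P j.-1 i - flat n mu P j i.+1 \is a Num.int,
        flat n mu P j i >= flat n mu P j.-1 i &
        flat n mu P j.-1 i >= flat n mu P j i.+1].
  move=> ij jr; have i1j : (1 <= i.+1 <= j)%N by lia.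
  have i0j : (1 <= i <= j)%N by lia.
  have ij1 : (1 <= i <= j.-1)%N by lia.
  rewrite /flat i1j i0j ij1; case: (ltngtP j n) => [jn|nj|jn].
  - have -> : (j.-1 < n)%N by lia.
    have [|a1 a2 a3] := H i; first lia.
    have [|b1 b2 b3] := H i.+1; first lia.
    split=> //; first by rewrite subrr.
      rewrite (_ : _ - _ = (P n i - P n i.+1) - (P n i - mu i) +
         (P n i.+1 - mu i.+1)); last lra.
      by apply: rpredD => //; apply: rpredB => //; apply: (pattern_int PP); lia.
    exact: le_trans b2 a1.
  - have -> : (j.-1 < n)%N = false by lia.
    by have [h1 h2] := il _ _ ij jr; have [h3 h4] := int _ _ ij jr; split.
  - subst j; have -> : (n.-1 < n)%N by lia.
    have [//|a1 a2 a3] := H i; split=> //.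
    rewrite (_ : _ - _ = (P n i - P n i.+1) - (P n i - mu i)); last lra.
    by apply: rpredB => //; apply: (pattern_int PP); lia.
split; [split|..].
- move=> j i h; rewrite /flat; case: ltnP => jn; last exact: P0.
  by rewrite (_ : (_ && _) = false)//; lia.
- by move=> j i ij jr; have [_ _ h1 h2] := key _ _ ij jr; apply: le_trans h2 h1.
- by move=> j i ij jr; have [_ _ h1 h2] := key _ _ ij jr.
- by move=> j i ij jr; have [h1 h2 _ _] := key _ _ ij jr.
- by move=> i ir; rewrite /flat ltnNge nr /=; apply: bd.
Qed.

(** Interlacing bounds the columns of [Q] below row [n] by row n-1, hence by [mu]; equal row sums
    then leave no room. *)
Lemma flat_unique n mu P Q : pat Q -> (n <= r.+1)%N ->
    (forall j, (n <= j)%N -> Q j = P j) ->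
    (forall q, (1 <= q < n)%N -> Q n.-1 q <= mu q) ->
    (forall k, (k < n)%N ->
       \sum_(1 <= q < k.+1) Q k q = \sum_(1 <= q < k.+1) mu q) ->
  Q = flat n mu P.
Proof.
move=> QP nr top le sums; apply/funext => k; apply/funext => q; rewrite /flat.
case: ltnP => kn; last by rewrite top.
case: ifPn => qk; last first.
  by have [[Q0 _ _] _ _] := QP; apply: Q0; apply: contra qk => /andP[].
apply: (eq_sum_le _ (sums k kn)) => // p pk.
by apply: (le_trans _ (le p _)); [apply: (pattern_col_mono QP)|]; lia.
Qed.

(** The composite of the shifts of entry [i] in the rows i, ..., n-1. On flat patterns it amounts to
    subtracting 1 from mu_i. *)
Definition lower n i P : pattern R := fun j q =>
  if ((i <= j < n) && (q == i))%N then P j q - 1 else P j q.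

Lemma lowerS n i P : (i <= n)%N -> lower n.+1 i P = shift (-1) n i (lower n i P).
Proof.
move=> le_in; apply/funext => j; apply/funext => q; rewrite /lower /shift.
have [->|qi] := eqVneq q i; rewrite ?andbF// ?andbT.
have [->|jn] := eqVneq j n; first by rewrite le_in ltnn ltnS leqnn.
by rewrite ltnS (ltn_neqAle j n) jn.
Qed.

Lemma lower_flat n i mu P : (1 <= i)%N ->
  lower n i (flat n mu P) = flat n (fun q => mu q - (q == i)%:R) P.
Proof.
move=> i1; apply/funext => j; apply/funext => q; rewrite /lower /flat.
case: (ltnP j n) => jn; last by rewrite andbF /=.
rewrite andbT; have [->|qi] := eqVneq q i; last by rewrite andbF subr0.
by rewrite i1 andbT; case: (i <= j)%N.
Qed.

(* A necessary condition for xi_Q to occur in E_{n,i} xi_P. *)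
Definition moves n i P Q : Prop :=
  [/\ forall j, (n <= j)%N -> Q j = P j,
      forall k, \sum_(1 <= q < k.+1) Q k q
                = \sum_(1 <= q < k.+1) P k q - (i <= k < n)%:R
    & forall k q, Q k q <= P k q].

Lemma moves_shift k p P : (1 <= p <= k)%N -> moves k.+1 k P (shift (-1) k p P).
Proof.
move=> pk; split.
- by move=> j kj; apply/funext => q; rewrite /shift (_ : (j == k) = false)//; lia.
- move=> j; rewrite /shift ltnS -eqn_leq eq_sym; have [->|jk] := eqVneq j k; last first.
    by rewrite subr0.
  rewrite /= (bigD1_seq p) ?iota_uniq//=; last by rewrite mem_index_iota; lia.
  rewrite [X in _ = X - _](bigD1_seq p) ?iota_uniq//=; last first.
    by rewrite mem_index_iota; lia.
  rewrite eqxx addrAC; congr (_ + _ - _).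
  by apply: eq_bigr => q /negPf ->.
- by move=> j q; rewrite /shift; case: ifP => // _; rewrite gerDl oppr_le0.
Qed.

(** The row n lowered by E_{n+1,n} completes the rows i, ..., n-1 lowered by E_{n,i}. The two cases
    are the two orders in the commutator. *)
Lemma movesS n i P S Q : (i <= n)%N ->
  moves n i P S /\ moves n.+1 n S Q \/ moves n.+1 n P S /\ moves n i S Q ->
  moves n.+1 i P Q.
Proof.
move=> le_in; case=> -[[a1 a2 a3] [b1 b2 b3]]; split.
- by move=> j jn; rewrite b1 ?a1//; lia.
- move=> k; rewrite b2 a2 -addrA -opprD -natrD; congr (_ - _%:R); lia.
- by move=> k q; apply: le_trans (b3 _ _) (a3 _ _).
- by move=> j jn; rewrite b1 ?a1//; lia.
- move=> k; rewrite b2 a2 -addrA -opprD -natrD; congr (_ - _%:R); lia.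
- by move=> k q; apply: le_trans (b3 _ _) (a3 _ _).
Qed.

End PatternLemmas.

(** * Matrix units as commutators *)

Lemma E_commutator (R : realType) (r n i : nat) : (1 <= i < n)%N -> (n <= r)%N ->
  E R r n.+1 i = E R r n.+1 n *m E R r n i - E R r n i *m E R r n.+1 n.
Proof.
move=> i_n n_r; rewrite /E mul_delta_mx mul_delta_mx_0 ?subr0//.
by rewrite -val_eqE /= !inordK; lia.
Qed.

Lemma tr_E (R : realType) (r i j : nat) : (1 <= i <= r.+1)%N -> (1 <= j <= r.+1)%N ->
  i != j -> \tr (E R r i j) = 0.
Proof.
move=> ir jr ij; rewrite /E /mxtrace big1// => k _; rewrite mxE.
case: andP => // -[/eqP -> /eqP e]; case/negP: ij.
by have := congr1 val e; rewrite /= !inordK; lia.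
Qed.

(** * Action of the operators E_{n,i} on the Gelfand-Tsetlin basis *)

Section Coefficients.
Variables (R : realType) (r : nat) (lam : r.+1.-tuple R).
Hypothesis lam_dom : dominant_integral lam.
Variables (V : vectType R[i]) (rho : 'M[R[i]]_r.+1 -> 'End(V)).
Hypothesis rho_rep : sl_representation rho.
Variables (v : V) (xi : pattern R -> V).
Hypothesis xi_GT : gelfand_tsetlin_basis rho lam v xi.
Variable coef : pattern R -> {scalar V}.
Local Notation pat := (patterns lam).
Hypothesis coef_sum :
  forall u, u = \sum_(P <- fset_set pat) coef P u *: xi P.
Hypothesis coef_xi :
  forall P Q, pat P -> pat Q -> coef P (xi Q) = (P == Q)%:R.
Implicit Types (P Q S : pattern R) (mu : nat -> R) (u : V) (T : 'End(V)).

Lemma mem_pat P : (P \in fset_set pat) <-> pat P.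
Proof. by rewrite in_fset_set ?inE//; exact: finite_patterns. Qed.

Lemma coef_app T u Q :
  coef Q (T u) = \sum_(P <- fset_set pat) coef P u * coef Q (T (xi P)).
Proof.
rewrite {1}(coef_sum u) !linear_sum; apply: eq_bigr => P _.
by rewrite !linearZ.
Qed.

Lemma coef_app_neq0 T u Q : coef Q (T u) != 0 ->
  exists P, [/\ pat P, coef P u != 0 & coef Q (T (xi P)) != 0].
Proof.
rewrite coef_app => h; apply: contrapT => nex; case/negP: h; apply/eqP.
rewrite big_seq big1// => P /mem_pat PP; apply/eqP; rewrite mulf_eq0.
by apply: contra_notT nex; rewrite negb_or => /andP[? ?]; exists P.
Qed.

Lemma coef_app_single T u Q P : pat P ->
    (forall S, pat S -> coef S u != 0 -> coef Q (T (xi S)) != 0 -> S = P) ->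
  coef Q (T u) = coef P u * coef Q (T (xi P)).
Proof.
move=> PP h; rewrite coef_app (bigD1_seq P) ?fset_uniq//=; last exact/mem_pat.
rewrite big_seq_cond big1 ?addr0// => S /andP[/mem_pat SS SP]; apply/eqP.
rewrite mulf_eq0; apply: contraR SP; rewrite negb_or => /andP[h1 h2].
exact/eqP/h.
Qed.

Lemma rhoB A B : \tr A = 0 -> \tr B = 0 -> rho (A *m B - B *m A) =
  ((rho A \o rho B) - (rho B \o rho A))%VF.
Proof. by move=> hA hB; case: (rho_rep hA hB). Qed.

Lemma rho_E_commutator n i u : (1 <= i < n)%N -> (n <= r)%N ->
  rho (E R r n.+1 i) u = rho (E R r n.+1 n) (rho (E R r n i) u)
                         - rho (E R r n i) (rho (E R r n.+1 n) u).
Proof.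
move=> i_n n_r; rewrite E_commutator// rhoB ?tr_E//; do ?lia.
by rewrite !lfun_simp.
Qed.

(** The Gelfand-Tsetlin coefficient of E_{k+1,k} from xi_P to xi at P - delta^k_i. *)
Definition gt_coef P k i : R :=
  (\prod_(1 <= q < k) (ell P k i - ell P k.-1 q)) /
  (\prod_(1 <= q < k.+1 | q != i) (ell P k i - ell P k q)).

Lemma shift_inj P k p p' : shift (-1) k p P = shift (-1) k p' P -> p = p'.
Proof.
move=> /(congr1 (fun S : pattern R => S k p)); rewrite /shift !eqxx /=.
by case: eqVneq => // _ e; exfalso; move: e; lra.
Qed.

Lemma coef_E P Q k : pat P -> pat Q -> (1 <= k <= r)%N ->
  coef Q (rho (E R r k.+1 k) (xi P)) =
  \sum_(1 <= p < k.+1) (gt_coef P k p)%:C%C * (Q == shift (-1) k p P)%:R.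
Proof.
move=> PP QP kr; have [_ _ h] := xi_GT; have [//|_ _ ->] := h P k PP.
rewrite linear_sum; apply: eq_bigr => p _; rewrite linearZ /=; congr (_ * _).
(* If the shift is not a pattern, [xi0] is 0 and so is the indicator, because [Q] is a pattern. *)
rewrite /xi0; case: ifPn => [/set_mem sP|nsP]; first exact: coef_xi.
rewrite linear0; case: eqP => // Qs; move: nsP; rewrite -Qs.
by rewrite mem_set.
Qed.

Lemma coef_E_neq0 P Q k : pat P -> pat Q -> (1 <= k <= r)%N ->
    coef Q (rho (E R r k.+1 k) (xi P)) != 0 ->
  exists2 p, (1 <= p <= k)%N & Q = shift (-1) k p P.
Proof.
move=> PP QP kr; rewrite coef_E// => h; apply: contrapT => nex.
case/negP: h; apply/eqP; rewrite big_nat_cond big1// => p; rewrite andbT => pk.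
by case: eqP => [Qs|]; rewrite ?mulr0//; case: nex; exists p.
Qed.

Lemma coef_E_shift P k p : pat P -> pat (shift (-1) k p P) -> (1 <= k <= r)%N ->
  (1 <= p <= k)%N ->
  coef (shift (-1) k p P) (rho (E R r k.+1 k) (xi P)) = (gt_coef P k p)%:C%C.
Proof.
move=> PP QP kr pk; rewrite coef_E// (bigD1_seq p) ?iota_uniq//=; last first.
  by rewrite mem_index_iota; lia.
rewrite eqxx mulr1 big1 ?addr0// => p' p'p.
case: eqP => [/shift_inj e|]; last by rewrite mulr0.
by rewrite e eqxx in p'p.
Qed.

(** Induction on [n]: in either order, the products of E_{n+1,n} and E_{n,i} in the commutator
    compose two moves. *)
Lemma coef_moves n i : (1 <= i < n)%N -> (n <= r.+1)%N -> forall P Q, pat P -> pat Q ->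
  coef Q (rho (E R r n i) (xi P)) != 0 -> moves n i P Q.
Proof.
elim: n => [|n IHn]; first by lia.
move=> i_n n_r P Q PP QP; have [->|ni] := eqVneq i n.
  move=> /coef_E_neq0[] //; first by lia.
  by move=> p pn ->; apply: moves_shift.
have E1 S S' : pat S -> pat S' -> coef S' (rho (E R r n.+1 n) (xi S)) != 0 ->
    moves n.+1 n S S'.
  move=> SP SP' /coef_E_neq0[] //; first by lia.
  by move=> p pn ->; apply: moves_shift.
have {}IHn S S' : pat S -> pat S' -> coef S' (rho (E R r n i) (xi S)) != 0 ->
    moves n i S S' by apply: IHn; lia.
rewrite rho_E_commutator; do ?lia.
rewrite linearB /= => h.
have : (coef Q (rho (E R r n.+1 n) (rho (E R r n i) (xi P))) != 0) ||
       (coef Q (rho (E R r n i) (rho (E R r n.+1 n) (xi P))) != 0).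
  apply: contraR h; rewrite negb_or !negbK => /andP[/eqP -> /eqP ->].
  by rewrite subr0.
have le_in : (i <= n)%N by lia.
case/orP=> /coef_app_neq0[S [SP h1 h2]]; apply: (movesS (S := S)) => //.
  by left; split; [exact: IHn|exact: E1].
by right; split; [exact: E1|exact: IHn].
Qed.

(** For q different from i, rows n-1 and n agree and the factors cancel; the numerator factor at i
    is 1. What is left is the denominator factor at n, which is absent when i = n. *)
Lemma gt_coef_flat P n i : pat P -> (1 <= i <= n)%N -> (n <= r.+1)%N ->
    (forall q, (1 <= q < n)%N -> P n.-1 q = P n q - (q == i)%:R) ->
  gt_coef P n i = if i == n then 1 else (ell P n i - ell P n n)^-1.
Proof.
move=> PP i_n n_r flatP.
(* Row [n] is non-increasing and -q is strictly decreasing, so the [ell] of one row are distinct. *)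
have ne q : (1 <= q <= n)%N -> q != i -> ell P n i - ell P n q != 0.
  move=> qn qi; rewrite /ell; apply/eqP.
  have [lt_iq|lt_qi|] := ltngtP i q; last by move=> e; rewrite e eqxx in qi.
  - have : P n q <= P n i by apply: (pattern_row_mono PP); lia.
    have : i%:R < q%:R :> R by rewrite ltr_nat.
    lra.
  - have : P n i <= P n q by apply: (pattern_row_mono PP); lia.
    have : q%:R < i%:R :> R by rewrite ltr_nat.
    lra.
rewrite /gt_coef; have [ei|in_] := eqVneq i n.
  rewrite -ei in flatP ne *.
  rewrite [X in _ / X]big_mkcond big_nat_recr ?eqxx /=; last lia.
  rewrite mulr1 [X in _ / X](eq_big_nat _ _ (F2 := fun q => ell P i i - ell P i.-1 q)).
    rewrite divff//; rewrite prodf_seq_neq0; apply/allP => q /=.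
    rewrite mem_index_iota => qi.
    rewrite /ell flatP// (_ : (q == i) = false) ?subr0; last by lia.
    by apply: ne; lia.
  move=> q qi; rewrite (_ : (q != i)) /ell ?flatP//; last by lia.
  by rewrite (_ : (q == i) = false) ?subr0//; lia.
have i1n : (1 <= i < n)%N by lia.
rewrite (bigD1_seq i) ?iota_uniq ?mem_index_iota//=.
rewrite [X in X * _ / _](_ : _ = 1); last by rewrite /ell flatP// eqxx mulr1n; lra.
rewrite mul1r big_mkcond [X in _ / X]big_mkcond big_nat_recr /=; last lia.
rewrite (_ : n != i) 1?eq_sym//.
rewrite [X in X / _](eq_big_nat _ _
  (F2 := fun q => if q != i then ell P n i - ell P n q else 1)); last first.
  by move=> q qn; case: ifPn => // qi; rewrite /ell flatP// (negPf qi) subr0.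
rewrite invfM mulrA divff ?mul1r//.
rewrite prodf_seq_neq0; apply/allP => q /=; rewrite mem_index_iota => qi.
by case: ifP => // h; [apply: ne => //; lia|rewrite oner_eq0].
Qed.

Definition decr i mu : nat -> R := fun q => mu q - (q == i)%:R.

Lemma flat_flat n mu P : flat n mu (flat n.+1 mu P) = flat n.+1 mu P.
Proof.
apply/funext => j; apply/funext => q; rewrite /flat ltnS.
by case: (ltngtP j n).
Qed.

(** Factors the transition made by E_{n+1,i} into one made by E_{n,i} followed by one made by
    E_{n+1,n}. *)
Lemma flat_decrS n i mu P : (1 <= i <= n)%N ->
  flat n.+1 (decr i mu) P = shift (-1) n i (flat n (decr i mu) (flat n.+1 mu P)).
Proof.
move=> i_n; rewrite -lower_flat; last lia.
by rewrite lowerS -?lower_flat ?flat_flat//; lia.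
Qed.

(** In E_{n+1,n} E_{n,i} - E_{n,i} E_{n+1,n} only the first product contributes, through the single
    intermediate pattern [P1]; the coefficient of E_{n+1,n} at [P1] is the new factor p = n. *)
Lemma coef_E_flat n i mu P : (1 <= i < n)%N -> (n <= r.+1)%N ->
    pat (flat n mu P) -> pat (flat n (decr i mu) P) ->
  coef (flat n (decr i mu) P) (rho (E R r n i) (xi (flat n mu P))) =
  (\prod_(i.+1 <= p < n) ((mu i - i%:R) - (mu p - p%:R))^-1)%:C%C.
Proof.
elim: n mu P => [|n IHn] mu P i_n n_r; first lia.
set P0 := flat n.+1 mu P => PP0; rewrite flat_decrS -/P0; last lia.
set P1 := flat n (decr i mu) P0 => PT.
have P0E j q : (1 <= q <= j)%N -> (j <= n)%N -> P0 j q = mu q.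
  by move=> qj jn; rewrite /P0 /flat ltnS jn qj.
have P1E q : (1 <= q < n)%N -> P1 n.-1 q = P0 n q - (q == i)%:R.
  move=> qn; rewrite /P1 /flat (_ : (n.-1 < n)%N); last lia.
  by rewrite (_ : (1 <= q <= n.-1)%N) ?P0E//; lia.
have P1n : P1 n = P0 n by apply/funext => q; rewrite /P1 /flat ltnn.
have PP1 : pat P1.
  apply: flat_pattern => //; first lia.
  move=> q qn; rewrite /decr P0E; [|lia|lia]; rewrite P0E; [|lia|lia].
  rewrite opprB addrCA subrr addr0; split; last exact: rpred_nat.
    have [e|qi] := eqVneq q i; last first.
      rewrite subr0 -(P0E n q) -?(P0E n q.+1); try lia.
      by apply: (pattern_row_mono PP0); lia.
    (* For q = i, the required mu_{i+1} <= mu_i - 1 is read off row [n] of the target pattern. *)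
    rewrite e in qn *; have : shift (-1) n i P1 n i.+1 <= shift (-1) n i P1 n i.
      by apply: (pattern_row_mono PT); lia.
    rewrite /shift !eqxx (_ : (i.+1 == i) = false) /=; last lia.
    by rewrite P1n !P0E//; lia.
  by rewrite gerBl ler0n.
have P1x q : (1 <= q <= n)%N -> ell P1 n q = mu q - q%:R + 1.
  by move=> qn; rewrite /ell P1n P0E//; lia.
have gt1 : gt_coef P1 n i = if i == n then 1 else (ell P1 n i - ell P1 n n)^-1.
  by apply: gt_coef_flat; rewrite ?P1n//; lia.
(* For i = n the operator is E_{n+1,n} itself, and [P1 = P0] since the rows below [n] have no entry
   n. *)
have [ei|ni] := eqVneq i n.
  have e1 : P1 = P0.
    rewrite /P1 -[RHS]flat_flat -/P0 ei.
    by apply: eq_flat => q qn; rewrite /decr (_ : (q == n) = false) ?subr0//; lia.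
  move: gt1; rewrite e1 ei eqxx => gt1.
  rewrite e1 ei in PT *; rewrite big_geq// coef_E_shift ?gt1//; lia.
have {}IHn : coef P1 (rho (E R r n i) (xi P0)) =
    (\prod_(i.+1 <= p < n) ((mu i - i%:R) - (mu p - p%:R))^-1)%:C%C.
  have F : flat n mu P0 = P0 by exact: flat_flat.
  by have := IHn mu P0; rewrite F; apply=> //; lia.
rewrite rho_E_commutator; [|lia|lia]; rewrite linearB /=.
(* Here E_{n+1,n} would lower entry [i] of row [n] while row n-1 still has mu_i there, against
   interlacing. *)
rewrite [X in _ - X](_ : _ = 0) ?subr0; last first.
  apply/eqP; apply: contraT => /coef_app_neq0[S [SP h1 h2]]; exfalso.
  have [|p pn ES] := coef_E_neq0 PP0 SP _ h1; first lia.
  have [||top _ _] := coef_moves (n := n) (i := i) _ _ SP PT h2; try lia.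
  have := congr1 (fun f => f i) (top n (leqnn _)); rewrite ES /shift !eqxx /= P1n.
  case: (eqVneq i p) => [ep _|_]; last by lra.
  have : S n.-1 i <= S n i by apply: (pattern_col_mono SP); lia.
  rewrite ES /shift -ep !eqxx (_ : (n.-1 == n) = false) /=; last lia.
  by rewrite !P0E; try lia; lra.
(* E_{n,i} keeps row [n], so E_{n+1,n} must lower its entry [i]; undoing this shift in the target
   gives [P1]. *)
rewrite (coef_app_single PP1) => [|S SP h1 h2]; last first.
  have [|p pn ES] := coef_E_neq0 SP PT _ h2; first lia.
  have [||top _ _] := coef_moves (n := n) (i := i) _ _ PP0 SP h1; try lia.
  have eip : p = i.
    have := congr1 (fun f => f n i) ES; rewrite /shift !eqxx /= P1n (top n (leqnn _)).
    by case: (eqVneq i p) => // _ e; exfalso; move: e; lra.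
  rewrite eip in ES; apply/funext => j; apply/funext => q.
  have := congr1 (fun f => f j q) ES; rewrite /shift.
  by case: ifP => // _; lra.
rewrite IHn coef_E_shift//; last lia.
rewrite gt1 (negPf ni) big_nat_recr /=; last lia.
rewrite rmorphM /=; congr (_ * (_^-1)%:C%C).
by rewrite !P1x; try lia; ring.
Qed.

(** The invariant carried through Theta: rows n, ..., r+1 are final and dominate those of [P], while
    below them only the row sums, that is the gl_(n-1)-weight [mu], are known. At n = 1 it is
    row-wise dominance. *)
Definition supp_inv n mu P u : Prop := forall Q, pat Q -> coef Q u != 0 ->
  (forall k, (k < n)%N ->
     \sum_(1 <= q < k.+1) Q k q = \sum_(1 <= q < k.+1) mu q) /\
  (forall j i, (n <= j <= r.+1)%N -> (1 <= i <= j)%N ->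
     \sum_(1 <= q < i.+1) P j q <= \sum_(1 <= q < i.+1) Q j q).

Lemma sum_decr mu i k : (1 <= i)%N -> \sum_(1 <= q < k.+1) decr i mu q =
  \sum_(1 <= q < k.+1) mu q - (i <= k)%:R.
Proof.
move=> i1; rewrite sumrB; congr (_ - _).
case: leqP => ik; last first.
  by rewrite big_nat_cond big1// => q /andP[qk _]; rewrite (_ : (q == i) = false)//; lia.
rewrite (bigD1_seq i) ?iota_uniq ?mem_index_iota ?i1//= eqxx big1 ?addr0//.
by move=> q /negPf ->.
Qed.

Lemma inv_E n i mu P u : (1 <= i < n)%N -> (n <= r.+1)%N -> supp_inv n mu P u ->
  supp_inv n (decr i mu) P (rho (E R r n i) u).
Proof.
move=> i_n n_r H Q QP /coef_app_neq0[S [SP h1 h2]].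
have [top sums _] := coef_moves i_n n_r SP QP h2.
have [e1 e2] := H S SP h1; split=> [k kn|j q jn qj].
  by rewrite sum_decr ?sums ?e1 ?kn ?andbT//; lia.
by rewrite top; [exact: e2|lia].
Qed.

Lemma coef_E_inv n i mu P u : (1 <= i < n)%N -> (n <= r.+1)%N -> supp_inv n mu P u ->
    pat (flat n mu P) -> pat (flat n (decr i mu) P) ->
    (forall q, (1 <= q < i)%N -> mu q = P n q) ->
  coef (flat n (decr i mu) P) (rho (E R r n i) u) = coef (flat n mu P) u *
  (\prod_(i.+1 <= p < n) ((mu i - i%:R) - (mu p - p%:R))^-1)%:C%C.
Proof.
move=> i_n n_r H PP PT muP; rewrite (coef_app_single PP) ?coef_E_flat//.
move=> S SP h1 h2; have [top _ le] := coef_moves i_n n_r SP PT h2.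
have [sums _] := H S SP h1.
have topS j : (n <= j)%N -> S j = P j.
  move=> nj; rewrite -top//; apply/funext => q.
  by rewrite /flat ltnNge nj.
have n1 : (n.-1 < n)%N by lia.
have lo q : (1 <= q < n)%N -> q != i -> mu q <= S n.-1 q.
  move=> qn qi; have := le n.-1 q; rewrite /flat n1 /decr (negPf qi) subr0.
  by rewrite (_ : (1 <= q <= n.-1)%N)//; lia.
(* [lo] gives one inequality; the other is interlacing, as mu_q is the entry of row [n]. *)
have eq_lt q : (1 <= q < i)%N -> mu q = S n.-1 q.
  move=> qi; apply/le_anti; rewrite lo ?andTb; [|lia|lia].
  by rewrite muP// -topS//; apply: (pattern_col_mono SP); lia.
(* A move may lower column [i], so [lo] does not apply; the known sum of row [i], which is at most
   that of the first i entries of row n-1, replaces it. *)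
have loi : mu i <= S n.-1 i.
  have : \sum_(1 <= q < i.+1) mu q <= \sum_(1 <= q < i.+1) S n.-1 q.
    rewrite -sums; last lia.
    by apply: ler_sum_nat => q qi; apply: (pattern_col_mono SP); lia.
  rewrite !big_nat_recr /=; try lia.
  by rewrite (eq_big_nat _ _ eq_lt) lerD2l.
apply: (flat_unique SP) => // q qn.
have := sums n.-1 n1 => /esym es.
rewrite (eq_sum_le _ es (q := q))//; last lia.
move=> p pn; have [->|pi] := eqVneq p i; first exact: loi.
by apply: lo => //; lia.
Qed.

(** * Powers of one operator E_{n,i} and factorials *)

Definition factn (x : R) : R[i] := (Num.truncn x)`!%:R.

Lemma factn_neq0 x : factn x != 0.
Proof. by rewrite /factn pnatr_eq0 -lt0n fact_gt0. Qed.

Lemma factn_dec x : x \is a Num.nat -> 1 <= x ->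
  factn (x - 1) / factn x = (x^-1)%:C%C.
Proof.
move=> /natrP[[|n] ->]; first by rewrite ler10.
move=> _; rewrite -natr1 addrK /factn natr1 !natrK factS natrM invfM.
rewrite mulrCA mulfV ?mulr1; last by rewrite pnatr_eq0 -lt0n fact_gt0.
by rewrite fmorphV /= rmorph_nat.
Qed.

Definition decrn i m mu : nat -> R := fun q => mu q - ((q == i) * m)%:R.

Lemma decr_decrn i m mu : decr i (decrn i m mu) = decrn i m.+1 mu.
Proof.
apply/funext => q; rewrite /decr /decrn mulnS natrD; lra.
Qed.

(** For each p, an application contributes 1/x = (x-1)!/x!, and x drops by 1 each time, so the
    product telescopes. *)
Lemma iter_E n i mu P u m : (1 <= i < n)%N -> (n <= r.+1)%N -> supp_inv n mu P u ->
    (forall k, (k <= m)%N -> pat (flat n (decrn i k mu) P)) ->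
    (forall q, (1 <= q < i)%N -> mu q = P n q) ->
  supp_inv n (decrn i m mu) P (iter m (comp_lfun (rho (E R r n i))) \1%VF u) /\
  coef (flat n (decrn i m mu) P) (iter m (comp_lfun (rho (E R r n i))) \1%VF u)
  = coef (flat n mu P) u * \prod_(i.+1 <= p < n)
     (factn ((mu i - m%:R - i%:R) - (mu p - p%:R)) /
      factn ((mu i - i%:R) - (mu p - p%:R))).
Proof.
move=> i_n n_r H pats muP; elim: m pats => [|m IHm] pats.
  have -> : decrn i 0 mu = mu by apply/funext => q; rewrite /decrn muln0 subr0.
  rewrite /= id_lfunE; split=> //; rewrite big1 ?mulr1// => p _.
  by rewrite subr0 divff ?factn_neq0.
have [k km|IH1 IH2] := IHm; first by apply: pats; lia.
rewrite iterS comp_lfunE -decr_decrn; split; first exact: inv_E.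
rewrite coef_E_inv//.
- rewrite IH2 -mulrA; congr (_ * _).
  rewrite rmorph_prod -big_split /=; apply: eq_big_nat => p pn.
  have n1 : (n.-1 < n)%N by lia.
  have p1 : (1 <= p <= n.-1)%N by lia.
  have i1 : (1 <= i <= n.-1)%N by lia.
  have Pm := pats m (leqnSn m); have Pm1 := pats m.+1 (leqnn _).
  (* Row n-1 of the target is non-increasing; with i < p this will give x >= 1. *)
  have le : decrn i m.+1 mu p <= decrn i m.+1 mu i.
    have : flat n (decrn i m.+1 mu) P n.-1 p <= flat n (decrn i m.+1 mu) P n.-1 i.
      by apply: (pattern_row_mono Pm1); lia.
    by rewrite /flat n1 p1 i1.
  have int : decrn i m mu i - decrn i m mu p \is a Num.int.
    have : flat n (decrn i m mu) P n.-1 i - flat n (decrn i m mu) P n.-1 p \is a Num.int.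
      by apply: (pattern_int lam_dom Pm); lia.
    by rewrite /flat n1 p1 i1.
  move: le int; rewrite /decrn eqxx (_ : (p == i) = false); last lia.
  rewrite !mul0n !mul1n !subr0 => le int.
  have ip : i%:R + 1 <= p%:R :> R by rewrite natr1 ler_nat; lia.
  set x := mu i - m%:R - i%:R - (mu p - p%:R).
  have xint : x \is a Num.int.
    rewrite (_ : x = (mu i - m%:R - mu p) + (p%:R - i%:R)) /x; last lra.
    by apply: rpredD => //; apply: rpredB; exact: natr_int.
  rewrite -factn_dec; last 2 first.
  - rewrite natrEint xint /=; move: le; rewrite -natr1 /x; lra.
  - by move: le; rewrite -natr1 /x; lra.
  rewrite [factn (mu i - m.+1%:R - _ - _)](_ : _ = factn (x - 1)); last first.
    by congr factn; rewrite -natr1 /x; lra.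
  rewrite mulrC -!mulrA; congr (_ * _).
  by rewrite mulKf ?factn_neq0.
- by apply: pats.
- by rewrite decr_decrn; apply: pats.
- by move=> q qi; rewrite /decrn (_ : (q == i) = false) ?mul0n ?subr0 ?muP//; lia.
Qed.

(** * The factors Theta^j *)

Lemma eq_inv n mu mu' P u : (forall q, (1 <= q < n)%N -> mu q = mu' q) ->
  supp_inv n mu P u -> supp_inv n mu' P u.
Proof.
move=> e H Q QP h; have [h1 h2] := H Q QP h; split=> // k kn.
by rewrite h1//; apply: eq_big_nat => q qk; apply: e; lia.
Qed.

Lemma inv_scale n mu P u c : supp_inv n mu P u -> supp_inv n mu P (c *: u).
Proof.
move=> H Q QP; rewrite linearZ mulf_eq0 negb_or => /andP[_]; exact: H.
Qed.

(* The weight reached when E_{j+1,q} has been applied for i <= q <= j only. *)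
Definition mix P j i : nat -> R := fun q => if (q < i)%N then P j.+1 q else P j q.

(** Entry [i] descends in unit steps from its value in row j+1 to its value in row j, so it never
    leaves the interlacing range. *)
Lemma mix_pattern P j i m : pat P -> (j <= r)%N -> (1 <= i <= j)%N ->
  (m <= Num.truncn (ell P j.+1 i - ell P j i))%N ->
  pat (flat j.+1 (decrn i m (mix P j i.+1)) P).
Proof.
move=> PP jr ij mle; have [[_ dec il] int _] := PP.
apply: flat_pattern => // q qj; rewrite /decrn /mix ltnS.
have [||h1 h2] := il j.+1 q; do ?lia.
have [||i1 i2] := int j.+1 q; do ?lia.
have := dec j.+1 q qj jr => {}dec; move: h1 h2 i1 i2 => /= h1 h2 i1 i2.
have [qi|qi|eqi] := ltngtP q i; rewrite ?mul0n ?subr0.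
- by rewrite subrr; split.
- by split.
rewrite mul1n opprB addrCA subrr addr0 eqi in h1 h2 i1 i2 *.
split; [|by rewrite gerBl ler0n|exact: natr_int].
apply: le_trans h2 _; rewrite lerBrDr -lerBrDl.
have -> : P j.+1 i - P j i = ell P j.+1 i - ell P j i by rewrite /ell; lra.
apply: (@le_trans _ _ (Num.truncn (ell P j.+1 i - ell P j i))%:R).
  by rewrite ler_nat.
by rewrite truncn_le /ell; lra.
Qed.

(** Descending induction on [i], as the rightmost factor E_{j+1,j} acts first and the entries left
    of the current one must still be maximal. *)
Lemma Theta_row_suffix P j u i : pat P -> (j <= r)%N -> (1 <= i <= j.+1)%N ->
    supp_inv j.+1 (P j.+1) P u ->
  let T := \big[@comp_lfun _ V V V / \1%VF]_(i <= q < j.+1)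
    divided_power (rho (E R r j.+1 q)) (Num.truncn (ell P j.+1 q - ell P j q)) in
  supp_inv j.+1 (mix P j i) P (T u) /\
  coef (flat j.+1 (mix P j i) P) (T u) = coef (flat j.+1 (P j.+1) P) u *
    \prod_(i <= q < j.+1) \prod_(q <= p < j.+1)
      (factn (ell P j q - ell P j p) / factn (ell P j.+1 q - ell P j p)).
Proof.
move=> PP jr ij H; have [d ijd] : exists d, (i + d = j.+1)%N.
  by exists (j.+1 - i)%N; lia.
elim: d i ij ijd => [|d IHd] i ij ijd.
  rewrite addn0 in ijd; rewrite ijd !big_geq//= id_lfunE.
  have e q : (1 <= q < j.+1)%N -> P j.+1 q = mix P j j.+1 q.
    by move=> qj; rewrite /mix ifT//; lia.
  by split; [exact: eq_inv H|rewrite mulr1 (eq_flat _ e)].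
have [||IH1 IH2] := IHd i.+1; try lia.
have i_j : (1 <= i < j.+1)%N by lia.
move: IH1 IH2; set T := (X in X u) => IH1 IH2 T'.
have -> : T' u = divided_power (rho (E R r j.+1 i))
    (Num.truncn (ell P j.+1 i - ell P j i)) (T u).
  by rewrite /T' big_ltn ?comp_lfunE//; lia.
rewrite /divided_power scale_lfunE.
set m := Num.truncn _.
have em : m%:R = P j.+1 i - P j i.
  have [[_ _ il] int _] := PP.
  have [||/= h1 h2] := il j.+1 i; do ?lia.
  have [||/= i1 i2] := int j.+1 i; do ?lia.
  have e : ell P j.+1 i - ell P j i = P j.+1 i - P j i by rewrite /ell; lra.
  by rewrite /m e truncnK// natrEint i1 subr_ge0.
have emix q : (1 <= q < j.+1)%N -> decrn i m (mix P j i.+1) q = mix P j i q.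
  move=> qj; rewrite /decrn /mix ltnS; case: (ltngtP q i) => [_|_|->].
  - by rewrite mul0n subr0.
  - by rewrite mul0n subr0.
  - by rewrite mul1n em; lra.
have [|k km|q qi|J1 J2] := @iter_E j.+1 i (mix P j i.+1) P (T u) m i_j _ IH1.
- by [].
- exact: mix_pattern.
- by rewrite /mix ifT//; lia.
split; first by apply: inv_scale; apply: eq_inv J1.
rewrite linearZ /= -(eq_flat _ emix) J2 IH2.
rewrite [in RHS]big_ltn; last lia.
rewrite [in RHS]big_ltn; last lia.
(* The factor p = i is 0!/m!, which is the 1/m! of the divided power. *)
rewrite [factn (ell P j i - ell P j i)](_ : _ = 1); last first.
  by rewrite subrr /factn truncn0.
rewrite mul1r -/(factn _).
rewrite (mulrC _^-1) -!mulrA; congr (_ * _).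
rewrite [X in _ * (X / _)](eq_big_nat _ _ (F2 := fun p =>
  factn (ell P j i - ell P j p) / factn (ell P j.+1 i - ell P j p))).
  by rewrite mulrCA mulrC mulrAC -!mulrA mulrC -!mulrA mulrCA.
move=> p pj; rewrite /mix ltnS leqnn ltnS leqNgt (_ : (i < p)%N) /=; last lia.
by rewrite em /ell; congr (factn _ / factn _); lra.
Qed.

(** Trades sums for dominance in row [j]: the sum of row i is known and, by interlacing, at most
    that of the first i entries of row [j]. *)
Lemma inv_pred P j u : (j <= r)%N -> supp_inv j.+1 (P j) P u -> supp_inv j (P j) P u.
Proof.
move=> jr H Q QP hQ; have [h1 h2] := H Q QP hQ; split=> [k kj|k i jk ik].
  by apply: h1; lia.
have [ekj|nkj] := eqVneq j k; last by apply: h2 => //; lia.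
rewrite -ekj in ik *; rewrite -h1; last lia.
by apply: ler_sum_nat => q qi; apply: (pattern_col_mono QP); lia.
Qed.

Lemma Theta_row_inv P j u : pat P -> (j <= r)%N ->
    supp_inv j.+1 (P j.+1) P u ->
  supp_inv j (P j) P (Theta_row rho P j u) /\
  coef (flat j (P j) P) (Theta_row rho P j u) = coef (flat j.+1 (P j.+1) P) u *
    \prod_(1 <= q < j.+1) \prod_(q <= p < j.+1)
      (factn (ell P j q - ell P j p) / factn (ell P j.+1 q - ell P j p)).
Proof.
move=> PP jr H; have [//|/= J1 J2] := Theta_row_suffix (i := 1) PP jr _ H.
have e q : (1 <= q < j.+1)%N -> mix P j 1 q = P j q.
  by move=> qj; rewrite /mix ifF//; lia.
split; first by apply: inv_pred => //; exact: eq_inv J1.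
by rewrite -(flat_pred PP) -?(eq_flat _ e)//; lia.
Qed.

(** * The highest weight vector and the full product Theta *)

Lemma top_pattern P : pat P -> pat (flat r.+1 (P r.+1) P).
Proof.
move=> PP; apply: flat_pattern => // q qr; rewrite subrr; split=> //.
by apply: (pattern_row_mono PP); lia.
Qed.

Lemma top_weight P : pat P -> has_weight lam (flat r.+1 (P r.+1) P).
Proof.
move=> PP; have [_ _ bd] := PP; exists 0 => k kr; rewrite addr0 /pattern_weight.
have e j q : (1 <= q <= j)%N -> (j <= r.+1)%N ->
    flat r.+1 (P r.+1) P j q = P r.+1 q.
  move=> qj jr; rewrite /flat qj; case: ltnP => // rj.
  by congr (P _ q); lia.
rewrite big_nat_recr /=; last lia.
rewrite e ?bd; [|lia|lia|lia]; rewrite addrAC.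
rewrite (eq_big_nat _ _ (F2 := P r.+1)) => [|q qk]; last by rewrite e//; lia.
rewrite [X in _ - X](eq_big_nat _ _ (F2 := P r.+1)) => [|q qk]; last by rewrite e//; lia.
by rewrite subrr add0r.
Qed.

(** All rows of this flat pattern are truncations of lambda, so it is the pattern of weight lambda,
    where [xi] is [v]. *)
Lemma coef_v P Q : pat P -> pat Q ->
  coef Q v = (Q == flat r.+1 (P r.+1) P)%:R.
Proof.
move=> PP QP; have [_ h _] := xi_GT.
by rewrite -(h _ (top_pattern PP) (top_weight PP)) coef_xi//; exact: top_pattern.
Qed.

Lemma Theta_suffix P n : pat P -> (1 <= n <= r.+1)%N ->
  let T := \big[@comp_lfun _ V V V / \1%VF]_(n <= j < r.+1) Theta_row rho P j in
  supp_inv n (P n) P (T v) /\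
  coef (flat n (P n) P) (T v) =
    \prod_(n <= j < r.+1) \prod_(1 <= q < j.+1) \prod_(q <= p < j.+1)
      (factn (ell P j q - ell P j p) / factn (ell P j.+1 q - ell P j p)).
Proof.
move=> PP nr; have [d nrd] : exists d, (n + d = r.+1)%N.
  by exists (r.+1 - n)%N; lia.
elim: d n nr nrd => [|d IHd] n nr nrd.
  rewrite addn0 in nrd; rewrite nrd !big_geq//= id_lfunE.
  split; last by rewrite (coef_v PP) ?eqxx//; exact: top_pattern.
  move=> Q QP; rewrite (coef_v PP QP) pnatr_eq0 eqb0 negbK => /eqP ->.
  split=> [k kr|j i rj ij].
    by apply: eq_big_nat => q qk; rewrite /flat kr; rewrite ifT//; lia.
  by rewrite /flat ltnNge; case/andP: rj => ->.
have [||/= I1 I2] := IHd n.+1; try lia.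
have [|J1 J2] := Theta_row_inv PP _ I1; first lia.
have n_r : (n < r.+1)%N by lia.
rewrite /= (big_ltn n_r) comp_lfunE (big_ltn n_r).
by split=> //; rewrite J2 I2 mulrC.
Qed.

Lemma coef_chari_loktev P : pat P ->
  (forall Q, pat Q -> coef Q (chari_loktev rho v P) != 0 -> rowwise_ge r Q P) /\
  coef P (chari_loktev rho v P) = diagonal_coef r P.
Proof.
move=> PP; have [//|I1 I2] := Theta_suffix (n := 1) PP; split.
  by move=> Q QP /(I1 Q QP)[_ h] i j ij jr; apply: h; lia.
(* The factor j = 1 of [diagonal_coef] is empty; the others are reindexed by j+1. *)
rewrite -{1}(flat1 (P 1%N) PP) I2 /diagonal_coef [RHS]big_ltn//.
by rewrite [X in _ = X * _]big_geq// mul1r [RHS]big_add1.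
Qed.

End Coefficients.

(** * Triangular expansion of the Chari-Loktev basis *)

Theorem theorem4 (R : realType) (r : nat) (r_ge1 : (1 <= r)%N)
    (lam : r.+1.-tuple R) (lam_dom : dominant_integral lam)
    (V : vectType R[i]) (rho : 'M[R[i]]_r.+1 -> 'End(V))
    (rho_rep : sl_representation rho) (rho_irr : irreducible_rep rho)
    (v : V) (v_hw : highest_weight_vector rho lam v)
    (xi : pattern R -> V) (xi_GT : gelfand_tsetlin_basis rho lam v xi) :
  exists c : pattern R -> pattern R -> R[i],
    forall P : pattern R, patterns lam P ->
      chari_loktev rho v P =
        \sum_(P' \in [set P' | patterns lam P' /\ rowwise_ge r P' P])
          c P P' *: xi P'
      /\ c P P = diagonal_coef r P.
Proof.
have fin := finite_patterns lam_dom.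
have [bs _ _] := xi_GT.
have [coef [coef_sum coef_mem]] := basis_coef (fset_uniq _) bs.
have coef_xi P Q : patterns lam P -> patterns lam Q ->
    coef P (xi Q) = (P == Q)%:R.
  by move=> PP QP; apply: coef_mem; rewrite in_fset_set ?inE.
exists (fun P P' => coef P' (chari_loktev rho v P)) => P PP.
have [ge diag] := coef_chari_loktev lam_dom rho_rep xi_GT coef_sum coef_xi PP.
(* The sum extends to all patterns, since the coordinates at patterns not dominating [P] vanish. *)
split=> //; rewrite (fsbig_widen _ (patterns lam)) => [|Q []//|Q [QP /= nQ]].
  by rewrite fsbig_finite.
apply/eqP; rewrite scaler_eq0; apply/orP; left; apply: contraT => /(ge Q QP) h.
by case: nQ.
Qed.
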